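(* Let $m\geq 1$. Let $\mathcal{C}_{2m}$ be the $\mathbb{Q}$-vector space of rational linear combinations of Chern numbers in complex dimension $2m$, let $\mathcal{EP}_{2m}\subset\mathcal{C}_{2m}$ be the subspace spanned by the Euler number and the Pontryagin numbers, and let $\mathcal{HT}_{2m}\subset\mathcal{C}_{2m}$ be the subspace spanned by the Hirzebruch--Todd numbers $T^0_{2m},\dots,T^{2m}_{2m}$. Then the intersection $\mathcal{EP}_{2m}\cap\mathcal{HT}_{2m}$ is two-dimensional over $\mathbb{Q}$, spanned by the Euler number and the signature.
   Context: $\mathcal{C}_{2m}$ is the $\mathbb{Q}$-vector space of linear combinations of Chern numbers of closed almost complex manifolds of complex dimension $2m$ (real dimension $4m$). It has as a basis the monomials $c_{i_1}\cdots c_{i_k}$ with $i_j\geq 1$ and $\sum_j i_j=2m$; that is, it is the degree-$2m$ part of the polynomial ring $\mathbb{Q}[c_1,c_2,\dots]$ graded by $\deg c_i=i$. $\mathcal{EP}_{2m}\subset\mathcal{C}_{2m}$ is the subspace spanned by the Euler number $e=c_{2m}$ and by the Pontryagin numbers $p_{i_1}\cdots p_{i_k}$ with $\sum_j i_j=m$, where $$p_i = c_i^2-2c_{i-1}c_{i+1}+2c_{i-2}c_{i+2}-\cdots+(-1)^i\, 2c_{2i}$$ (with $c_0=1$) are the Pontryagin classes. $\mathcal{HT}_{2m}\subset\mathcal{C}_{2m}$ is the subspace spanned by the Hirzebruch--Todd numbers $T^p_{2m}\in\mathcal{C}_{2m}$, $0\leq p\leq 2m$, defined by the expansion $$T_{2m}(y;c_1,\ldots,c_{2m})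 = \sum_{p=0}^{2m}T^p_{2m}(c_1,\ldots,c_{2m})\,y^p,$$ where $T_{n}(y;c_1,\ldots,c_{n})$ is the multiplicative sequence corresponding to the power series $$Q(y;x) = x +\frac{x(y+1)}{e^{x(y+1)}-1}$$ in $x$; that is, $T_n(y;c_1,\dots,c_n)$ is the homogeneous degree-$n$ part (in the variables $x_i$) of $\prod_{i=1}^n Q(y;x_i)$, written as a polynomial in the elementary symmetric functions $c_i$ of $x_1,\dots,x_n$. The signature is regarded as an element of $\mathcal{C}_{2m}$ via the Hirzebruch signature theorem: it is the $L$-genus $L_m(p_1,\dots,p_m)$, where $(L_j)$ is the multiplicative sequence in the Pontryagin classes associated with the power series $\sqrt{z}/\tanh\sqrt{z}$; equivalently, it is the degree-$2m$ part of $\prod_{i=1}^{2m} x_i/\tanh x_i$ expressed in the elementary symmetric functions $c_i$ of $x_1,\dots,x_{2m}$. *)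

(* Defs.v *)
From HB Require Import structures.
From mathcomp Require Import all_boot all_order all_fingroup all_algebra.
From mathcomp Require Export mpoly.

Set Implicit Arguments.
Unset Strict Implicit.
Unset Printing Implicit Defensive.

Import GRing.Theory.
Local Open Scope ring_scope.

Section PowerSeries.
Context {R : unitRingType}.
Implicit Types a b : nat -> R.

Definition ps_mul a b (k : nat) : R := \sum_(i < k.+1) a i * b (k - i)%N.

(* [ps_inv_rev a k] is [:: b_(k-1); ...; b_0] for the inverse series b of a. *)
Fixpoint ps_inv_rev a (k : nat) : seq R :=
  if k is k'.+1 then
    let s := ps_inv_rev a k' in
    (a 0%N)^-1 * ((k' == 0%N)%:R - \sum_(i < k') a i.+1 * s`_i) :: s
  else [::].

Definition ps_inv a (k : nat) : R := (ps_inv_rev a k.+1)`_0.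

Lemma ps_inv_rev_nth a k i : (i < k)%N ->
  (ps_inv_rev a k)`_i = ps_inv a (k - i.+1)%N.
Proof.
elim: k i => // k IHk [|i] ltik; first by rewrite subn1.
by rewrite subSS -IHk.
Qed.

Lemma ps_mulV a k : a 0%N \is a GRing.unit ->
  ps_mul a (ps_inv a) k = (k == 0%N)%:R.
Proof.
move=> ua; rewrite /ps_mul big_ord_recl subn0 {1}/ps_inv /= mulVKr //.
rewrite -[RHS](subrK (\sum_(i < k) a i.+1 * (ps_inv_rev a k)`_i)).
congr (_ + _); apply: eq_bigr => i _.
by rewrite ps_inv_rev_nth.
Qed.

End PowerSeries.

(* [mnmwgt] gives the variable of index i weight i + 1. *)
Section Weight.
Context {R : comNzRingType}.

Lemma whomog_comp n k d e (f : {mpoly R[n]}) (t : n.-tuple {mpoly R[k]}) :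
    f \is d.-homog for mnmwgt ->
    (forall i : 'I_n, tnth t i \is (e * i.+1)%N.-homog for mnmwgt) ->
  f \mPo t \is (e * d)%N.-homog for mnmwgt.
Proof.
move=> /dhomogP fd te; rewrite comp_mpolyE big_seq; apply: rpred_sum => a /fd wa.
apply: rpredZ; rewrite -wa /= /mnmwgt.
rewrite big_distrr /=.
elim/big_rec2: _ => [|i x y _ hx]; first exact: dhomog1.
apply: dhomogM => //; rewrite (mulnC (a i)) mulnA; exact: dhomogMn.
Qed.

End Weight.

(* [multseq q n] is the polynomial K_n(c_1, ..., c_n) of the multiplicative
   sequence of the series sum_k q_k x^k; its variable of index i stands for
   c_(i + 1). Truncating each factor after x^n does not affect degree n. *)
Section MultSeq.
Context {R : idomainType}.
Implicit Types q : nat -> R.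

Definition genus_part q n : {mpoly R[n]} :=
  pihomog mdeg n (\prod_(i < n) \sum_(k < n.+1) q k *: 'X_i ^+ k).

Definition multseq q n : {mpoly R[n]} := symf (genus_part q n).

Lemma genus_part_sym q n : genus_part q n \is symmetric.
Proof.
apply/pihomog_sym/issymP => s.
rewrite rmorph_prod /= (reindex_inj (@perm_inj _ s^-1%g)) /=.
apply: eq_bigr => i _; rewrite linear_sum; apply: eq_bigr => k _ /=.
rewrite linearZ /= rmorphXn /=; congr (_ *: _ ^+ _).
by rewrite msymX; congr 'X_[_]; apply/mnmP => j; rewrite !mnmE (inj_eq perm_inj).
Qed.

Lemma multseqE q n :
  multseq q n \mPo [tuple mesym n R i.+1 | i < n] = genus_part q n.
Proof. by rewrite -symfP ?genus_part_sym. Qed.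

Lemma multseq_homog q n : multseq q n \is n.-homog for mnmwgt.
Proof. by rewrite mwmwgt_homogE multseqE pihomogP. Qed.

End MultSeq.

(* The degree-n part of Q[c_1, c_2, ...] only involves c_1, ..., c_n, so it is
   taken inside Q[c_1, ..., c_n]; the variable 'X_i is c_(i + 1). *)
Record chern_numbers (n : nat) := ChernNumber {
  chern_poly :> {mpoly rat[n]};
  _ : chern_poly \is n.-homog for mnmwgt }.

Section ChernNumbersVector.
Variable n : nat.

HB.instance Definition _ := [isSub for @chern_poly n].
HB.instance Definition _ := [Choice of chern_numbers n by <:].
HB.instance Definition _ := [SubChoice_isSubLmodule of chern_numbers n by <:].

Let I : pred 'X_{1..n < n.+1} := fun a => mnmwgt a == n.

Lemma chern_numbers_vecaxiom : Vector.axiom #|I| (chern_numbers n).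
Proof.
pose f (u : chern_numbers n) : 'rV[rat]_#|I| := \row_i (val u)@_(bmnm (enum_val i)).
pose g0 (r : 'rV[rat]_#|I|) : {mpoly rat[n]} :=
  \sum_(i < #|I|) r 0 i *: 'X_[bmnm (enum_val i)].
have g0P r : g0 r \is n.-homog for mnmwgt.
  apply: rpred_sum => i _; apply: rpredZ; rewrite dhomogX.
  exact: (enum_valP i).
exists f; first by move=> c u v; apply/rowP => i; rewrite !mxE linearP.
exists (fun r => ChernNumber (g0P r)) => [u | r].
  apply/val_inj/mpolyP => a /=; rewrite linear_sum /=.
  have [aI|naI] := eqVneq (mnmwgt a) n; last first.
    rewrite (dhomog_nemf_coeff (valP u)) // big1 // => i _.
    rewrite mcoeffZ mcoeffX; case: eqP => [e|]; rewrite ?mulr0 //.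
    by rewrite -e (eqP (enum_valP i)) eqxx in naI.
  have lta : (mdeg a < n.+1)%N by rewrite ltnS -{2}aI leq_mdeg_mnmwgt.
  have aI' : BMultinom lta \in I by apply/eqP.
  rewrite (bigD1 (enum_rank_in aI' (BMultinom lta))) //= big1 => [|i ne].
    by rewrite mxE mcoeffZ mcoeffX enum_rankK_in //= eqxx mulr1 addr0.
  rewrite mcoeffZ mcoeffX; case: eqP => [e|]; rewrite ?mulr0 //.
  case/eqP: ne; rewrite -(enum_valK_in aI' i); congr (enum_rank_in _ _).
  exact: val_inj.
apply/rowP => i; rewrite mxE linear_sum /= (bigD1 i) //= big1 => [|j ne].
  by rewrite mcoeffZ mcoeffX eqxx mulr1 addr0.
rewrite mcoeffZ mcoeffX; case: eqP => [e|]; rewrite ?mulr0 //.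
by case/eqP: ne; apply/enum_val_inj/val_inj.
Qed.

HB.instance Definition _ :=
  Lmodule_hasFinDim.Build rat (chern_numbers n) chern_numbers_vecaxiom.

End ChernNumbersVector.

(* c_0 = 1, and c_k = 0 for k > n. *)
Definition chern_class (n k : nat) : {mpoly rat[n]} :=
  if k is j.+1 then oapp (fun i : 'I_n => 'X_i) 0 (insub j) else 1.

Lemma chern_class_homog n k : chern_class n k \is k.-homog for mnmwgt.
Proof.
case: k => [|j] /=; first exact: dhomog1.
case: insubP => [i _ <-|_] /=; last exact: dhomog0.
by rewrite dhomogX /= mnmwgt1.
Qed.

Definition euler (n : nat) : chern_numbers n :=
  ChernNumber (chern_class_homog n n).

Definition pontryagin_class (n i : nat) : {mpoly rat[n]} :=
  chern_class n i ^+ 2 +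
  \sum_(1 <= j < i.+1)
     ((-1) ^+ j * 2%:R) *: (chern_class n (i - j) * chern_class n (i + j)).

Lemma pontryagin_class_homog n i :
  pontryagin_class n i \is (2 * i)%N.-homog for mnmwgt.
Proof.
apply: rpredD; first by rewrite mulnC; exact/dhomogMn/chern_class_homog.
rewrite big_nat; apply: rpred_sum => j /andP[_ ltji]; apply: rpredZ.
have -> : (2 * i = (i - j) + (i + j))%N by rewrite addnCA subnK // addnn mul2n.
by apply: dhomogM; apply: chern_class_homog.
Qed.

(* Substitutes p_1, ..., p_m, in complex dimension 2m, for the variables. *)
Definition pontryagin_subst (m : nat) (f : {mpoly rat[m]}) :
    {mpoly rat[2 * m]} :=
  f \mPo [tuple pontryagin_class (2 * m) i.+1 | i < m].

Lemma pontryagin_subst_homog m (f : {mpoly rat[m]}) : f \is m.-homog for mnmwgt ->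
  pontryagin_subst f \is (2 * m)%N.-homog for mnmwgt.
Proof.
move=> fm; apply: whomog_comp => // i.
by rewrite tnth_mktuple pontryagin_class_homog.
Qed.

(* The partitions of m, written as monomials of weight m in p_1, ..., p_m;
   weight m forces degree at most m, so the degree bound is harmless. *)
Definition pontryagin_index (m : nat) :=
  {a : 'X_{1..m < m.+1} | mnmwgt a == m}.

Lemma pontryagin_index_homog m (a : pontryagin_index m) :
  'X_[rat, val a] \is m.-homog for mnmwgt.
Proof. by rewrite dhomogX; exact: (valP a). Qed.

Definition pontryagin_number (m : nat) (a : pontryagin_index m) :
    chern_numbers (2 * m) :=
  ChernNumber (pontryagin_subst_homog (pontryagin_index_homog a)).

(* sqrt z / tanh (sqrt z) = cosh (sqrt z) / (sinh (sqrt z) / sqrt z), where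
   cosh (sqrt z) = sum_k z^k / (2k)! and
   sinh (sqrt z) / sqrt z = sum_k z^k / (2k + 1)!. *)
Definition L_series : nat -> rat :=
  ps_mul (fun k => ((2 * k)%N`!%:R)^-1)
         (ps_inv (fun k => ((2 * k)%N.+1`!%:R)^-1)).

Definition signature (m : nat) : chern_numbers (2 * m) :=
  ChernNumber (pontryagin_subst_homog (multseq_homog L_series m)).

(* x / (e^x - 1) = 1 / sum_k x^k / (k + 1)! *)
Definition todd_series : nat -> rat := ps_inv (fun k => (k.+1`!%:R)^-1).

(* Q(y; x) = x + x (y + 1) / (e^(x (y + 1)) - 1), as a series in x with
   coefficients in Q[y]. *)
Definition Q_series (k : nat) : {poly rat} :=
  (k == 1%N)%:R + todd_series k *: ('X + 1) ^+ k.

Lemma map_coefp_homog n d p (f : {mpoly {poly rat}[n]}) :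
  f \is d.-homog for mnmwgt ->
  map_mpoly (coefp p) f \is d.-homog for mnmwgt.
Proof.
move=> /dhomogP fd; apply/dhomogP => a.
rewrite mcoeff_msupp mcoeff_map_mpoly => nz; apply: fd.
by rewrite mcoeff_msupp; apply: contraNneq nz => ->; rewrite /= coef0.
Qed.

(* T^p_n: the coefficient of y^p in T_n(y; c_1, ..., c_n). *)
Definition todd_number (n p : nat) : chern_numbers n :=
  ChernNumber (map_coefp_homog p (multseq_homog Q_series n)).

Definition EP (m : nat) : {vspace chern_numbers (2 * m)} :=
  (<[euler (2 * m)]>
   + <<[seq pontryagin_number a | a : pontryagin_index m]>>)%VS.

Definition HT (m : nat) : {vspace chern_numbers (2 * m)} :=
  <<[seq todd_number (2 * m) p | p : 'I_(2 * m).+1]>>%VS.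

(* Main.v *)
(* Writing z / (e^z - 1) = - z / 2 + E(z) with E(z) = (z / 2) coth (z / 2)
   even, one gets Q(y; x) = x (1 - y) / 2 + E((1 + y) x). Hence, in even degree
   n and in terms of the Chern roots x_1, ..., x_n,
     T_n(y) = sum_s ((1 - y) / 2)^s (1 + y)^(n - s) F_s,
   where F_s collects the monomials with exactly s odd exponents. So HT is
   contained in the span of the F_s, which lie in distinct parity sectors;
   F_0 is the signature up to the factor 2^n (take y = 1) and F_n is the Euler
   number (take y = -1). Since the Pontryagin classes are the elementary
   symmetric functions of the x_i^2, elements of EP only contain monomials with
   0 or n odd exponents, so an element of both spaces has no component along
   F_s for 0 < s < n. Both F_0 and F_n are nonzero, hence independent. *)
From HB Require Import structures.
Require Import Defs.
From mathcomp Require Import all_boot all_order all_algebra.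
From mathcomp Require Import perm ring lra zify.

Set Implicit Arguments.
Unset Strict Implicit.
Unset Printing Implicit Defensive.

Import GRing.Theory Num.Theory.
Local Open Scope ring_scope.

(** * Symmetric polynomials *)

Section Coefficients.
Variables (R : comNzRingType) (n : nat).
Implicit Types (a b : 'X_{1..n}) (q : nat -> R).

Lemma mcoeff_pihomog (mf : measure n) d (p : {mpoly R[n]}) a :
  (pihomog mf d p)@_a = if mf a == d then p@_a else 0.
Proof.
elim/mpolyind: p => [|c b p _ _ IHp]; first by rewrite linear0 mcoeff0 if_same.
rewrite linearP /= !mcoeffD !mcoeffZ IHp pihomogX mcoeffX.
have [eab|nab] := eqVneq b a.
  by rewrite eab; case: ifP; rewrite ?mcoeff0 ?mcoeffX ?eqxx // mulr0 addr0.
case: (mf b == d); rewrite ?mcoeffX ?mcoeff0 ?(negPf nab) ?mulr0 ?add0r //.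
Qed.

Lemma mcoeff_prod_trunc q N a : (forall i, a i < N)%N ->
  (\prod_(i < n) \sum_(k < N) q k *: 'X_i ^+ k)@_a = \prod_(i < n) q (a i).
Proof.
move=> ltaN; rewrite bigA_distr_bigA /= raddf_sum /=.
pose g (f : {ffun 'I_n -> 'I_N}) : 'X_{1..n} := [multinom (f i : nat) | i < n].
have termE (f : {ffun 'I_n -> 'I_N}) :
    \prod_(i < n) (q (f i) *: ('X_i : {mpoly R[n]}) ^+ f i) =
    (\prod_(i < n) q (f i)) *: 'X_[g f].
  rewrite scaler_prod; congr (_ *: _); rewrite mpolyXE_id.
  by apply: eq_bigr => i _; rewrite mnmE.
pose f0 : {ffun 'I_n -> 'I_N} := [ffun i => Ordinal (ltaN i)].
rewrite (bigD1 f0) //= termE mcoeffZ mcoeffX.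
have -> : g f0 = a by apply/mnmP => i; rewrite mnmE ffunE.
rewrite eqxx mulr1 [X in _ + X]big1 => [|f nf].
  by rewrite addr0; apply: eq_bigr => i _; rewrite ffunE.
rewrite termE mcoeffZ mcoeffX; case: eqP => [gfa|]; last by rewrite mulr0.
case/eqP: nf; apply/ffunP => i; rewrite ffunE; apply/val_inj => /=.
by rewrite -gfa mnmE.
Qed.

Lemma leq_mnm_mdeg a i : (a i <= mdeg a)%N.
Proof. by rewrite mdegE (bigD1 i) //= leq_addr. Qed.

End Coefficients.

Lemma mcoeff_genus_part (R : idomainType) (q : nat -> R) n (a : 'X_{1..n}) :
  (genus_part q n)@_a = if mdeg a == n then \prod_(i < n) q (a i) else 0.
Proof.
rewrite mcoeff_pihomog; case: eqP => // dega.
by rewrite mcoeff_prod_trunc // => i; rewrite ltnS -{2}dega leq_mnm_mdeg.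
Qed.

Section ElementarySymmetric.
Variables (A : comNzRingType).

(** The generating function of the elementary symmetric functions, kept for arbitrary [z] so that it
    also serves for negated, squared or vanishing variables. *)
Lemma coef_prod_1addZX n (z : 'I_n -> A) k :
  (\prod_(i < n) (1 + z i *: 'X))`_k =
  \sum_(h : {set 'I_n} | #|h| == k) \prod_(i in h) z i.
Proof.
under eq_bigr do rewrite addrC.
rewrite bigA_distr /= coef_sum [RHS]big_mkcond /=; apply: eq_bigr => h _.
rewrite -big_mkcond /= scaler_prod prodr_const coefZ coefXn eq_sym.
by case: eqP; rewrite ?mulr1 ?mulr0.
Qed.
End ElementarySymmetric.

(** * Setting all but the first m variables to zero *)

Section Restriction.
Variables (R : comNzRingType) (n m : nat).

Definition restr_vars : n.-tuple {mpoly R[m]} :=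
  [tuple oapp (fun j : 'I_m => 'X_j) 0 (insub (val i)) | i < n].

Definition extend_mnm (b : 'X_{1..m}) : 'X_{1..n} :=
  [multinom oapp b 0%N (insub (val i)) | i < n].

Hypothesis lemn : (m <= n)%N.

Lemma mcoeff_restr (g : {mpoly R[n]}) b :
  (g \mPo restr_vars)@_b = g@_(extend_mnm b).
Proof.
elim/mpolyind: g => [|c a p _ _ IHp]; first by rewrite linear0 !mcoeff0.
rewrite linearP /= !mcoeffD !mcoeffZ IHp; congr (c * _ + _).
rewrite comp_mpolyX mcoeffX (bigID (fun i : 'I_n => i < m)%N) /=.
rewrite (big_ord_narrow lemn) /=.
under eq_bigr => i _ do rewrite tnth_mktuple valK /=.
(* A monomial [a] supported on the first m variables survives as [a']; any other is sent to 0 and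
   differs from [extend_mnm b]. *)
have [/forallP a0|/forallPn[i]] :=
    boolP [forall i : 'I_n, (i < m)%N || (a i == 0%N)].
  rewrite [X in _ * X]big1 => [|i nltim]; last first.
    by have := a0 i; rewrite (negPf nltim) => /eqP ->; rewrite expr0.
  pose a' : 'X_{1..m} := [multinom a (widen_ord lemn j) | j < m].
  rewrite mulr1 (_ : \prod_(i < m) _ = 'X_[a']); last first.
    by rewrite mpolyXE_id; apply: eq_bigr => i _; rewrite mnmE.
  rewrite mcoeffX; congr (nat_of_bool _)%:R; apply/eqP/eqP => [<-|ea].
    apply/mnmP => i; rewrite mnmE; case: insubP => [j _ ej|nltim] /=.
      by rewrite mnmE; congr (a _); apply: val_inj; rewrite /= ej.
    by apply/eqP; have := a0 i; rewrite (negPf nltim).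
  by apply/mnmP => j; rewrite mnmE ea mnmE /= valK.
rewrite negb_or => /andP[nltim ai].
rewrite [X in _ * X](bigD1 i) //= tnth_mktuple insubN //= expr0n (negPf ai).
rewrite mul0r mulr0 mcoeff0; case: eqP => // ea.
by move: ai; rewrite ea mnmE insubN.
Qed.

Lemma mesym_restr k : mesym n R k \mPo restr_vars = mesym m R k.
Proof.
rewrite /mesym raddf_sum /=.
under eq_bigr do rewrite rmorph_prod /=.
rewrite -!coef_prod_1addZX; congr (_`_k).
rewrite (bigID (fun i : 'I_n => i < m)%N) /= (big_ord_narrow lemn) /=.
rewrite [X in _ * X]big1 => [|i nltim]; last first.
  by rewrite comp_mpolyXU -tnth_nth tnth_mktuple insubN //= scale0r addr0.
rewrite mulr1; under eq_bigr => i _.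
  rewrite comp_mpolyXU -tnth_nth tnth_mktuple /= valK; over.
by [].
Qed.
End Restriction.

Lemma mcomp_dhomog (R : comNzRingType) n k d (f : {mpoly R[n]})
    (t : n.-tuple {mpoly R[k]}) :
    f \is d.-homog for mnmwgt ->
    (forall i : 'I_n, tnth t i \is i.+1.-homog) ->
  f \mPo t \is d.-homog.
Proof.
move=> /dhomogP fd tH.
rewrite comp_mpolyE big_seq; apply: rpred_sum => a /fd <-.
apply: rpredZ; rewrite /mnmwgt.
apply: (big_rec2 (fun (p : {mpoly R[k]}) e => p \is e.-homog)).
  exact: dhomog1.
by move=> i x y _ hx; apply: dhomogM => //; rewrite mulnC; apply: dhomogMn.
Qed.

Lemma comp_mpolyA (R : comNzRingType) n k l (f : {mpoly R[n]})
    (t : n.-tuple {mpoly R[k]}) (u : k.-tuple {mpoly R[l]}) :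
  (f \mPo t) \mPo u = f \mPo [tuple tnth t i \mPo u | i < n].
Proof.
rewrite (comp_mpolyE f) [RHS]comp_mpolyE raddf_sum /=; apply: eq_bigr => a _.
rewrite linearZ rmorph_prod /=; congr (_ *: _); apply: eq_bigr => i _.
by rewrite rmorphXn tnth_mktuple.
Qed.

(* By symmetry the leading monomial of a symmetric polynomial has nonincreasing
   exponents, so in degree m it involves at most the first m variables. *)
Lemma sym_dhomog_restr_eq0 (R : comNzRingType) n m (g : {mpoly R[n]}) :
    (m <= n)%N -> g \is mpoly.symmetric -> g \is m.-homog ->
  g \mPo restr_vars R n m = 0 -> g = 0.
Proof.
move=> lemn gsym ghom g0; apply/eqP; rewrite -mleadc_eq0.
apply/negPn/negP => nz.
pose a := mlead g; have dega : mdeg a = m.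
  by move/dhomogP: ghom; apply; rewrite mcoeff_msupp.
have a0 (i : 'I_n) : (m <= i)%N -> a i = 0%N.
  move=> lemi; apply/eqP/negPn; rewrite -lt0n; apply/negP => ai.
  suff : (m < mdeg a)%N by rewrite dega ltnn.
  rewrite mdegE (bigID (fun j : 'I_n => j <= i)%N) /=; apply: ltn_addr.
  apply: (@leq_trans (\sum_(j < n | (j <= i)%N) 1)); last first.
    by apply: leq_sum => j /(mlead_msym_sorted gsym); apply: leq_trans.
  rewrite (big_ord_narrow (ltn_ord i)) sum_nat_const card_ord muln1.
  by rewrite ltnS.
pose b : 'X_{1..m} := [multinom a (widen_ord lemn j) | j < m].
have := congr1 (mcoeff b) g0; rewrite mcoeff_restr // mcoeff0.
have -> : extend_mnm n b = a; last by apply/eqP.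
apply/mnmP => i; rewrite mnmE; case: insubP => [j _ ej|nltim] /=.
  by rewrite mnmE; congr (a _); apply: val_inj; rewrite /= ej.
by rewrite a0 // leqNgt.
Qed.

Section Stability.
Variables (R : idomainType) (q : nat -> R) (n m : nat).
Hypotheses (lemn : (m <= n)%N) (q0 : q 0%N = 1).

(** Stability in the number of variables: both sides are symmetric forms of degree m, so it suffices
    to compare them after restriction to m variables, where [multseqE] applies. *)
Lemma mcoeff_multseq_mesym (a : 'X_{1..n}) :
  (multseq q m \mPo [tuple mesym n R i.+1 | i < m])@_a =
  if mdeg a == m then \prod_(i < n) q (a i) else 0.
Proof.
pose H : {mpoly R[n]} :=
  pihomog mdeg m (\prod_(i < n) \sum_(k < m.+1) q k *: 'X_i ^+ k).
have HE b : H@_b = if mdeg b == m then \prod_(i < n) q (b i) else 0.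
  rewrite mcoeff_pihomog; case: eqP => // degb.
  by rewrite mcoeff_prod_trunc // => i; rewrite ltnS -degb leq_mnm_mdeg.
rewrite -HE; congr (_@__); apply/eqP; rewrite -subr_eq0; apply/eqP.
apply: (sym_dhomog_restr_eq0 lemn).
- apply: rpredB.
    by apply: mcomp_sym => i; rewrite -tnth_nth tnth_mktuple mesym_sym.
  apply/issymP => s; apply/mpolyP => b; rewrite mcoeff_sym !HE mdeg_mperm.
  case: ifP => // _; rewrite [RHS](reindex_inj (@perm_inj _ s)) /=.
  by apply: eq_bigr => i _; rewrite mnmE.
- apply: rpredB; last exact: pihomogP.
  apply: mcomp_dhomog; first exact: multseq_homog.
  by move=> i; rewrite tnth_mktuple dhomog_mesym.
rewrite raddfB /= comp_mpolyA; apply/eqP; rewrite subr_eq0; apply/eqP.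
have -> : [tuple tnth [tuple mesym n R j.+1 | j < m] i \mPo restr_vars R n m
           | i < m] = [tuple mesym m R i.+1 | i < m].
  by apply: eq_from_tnth => i; rewrite !tnth_mktuple mesym_restr.
rewrite multseqE; apply/mpolyP => b; rewrite mcoeff_genus_part mcoeff_restr //.
(* Used for the degree (a sum, [F] the identity) and for the coefficient (a product, [F] being [q]),
   where the variables beyond m contribute [q 0] = 1. *)
have splitE (S : Type) (x0 : S) (op : Monoid.com_law x0) (F : nat -> S) :
    F 0%N = x0 ->
    \big[op/x0]_(i < n) F (extend_mnm n b i) = \big[op/x0]_(i < m) F (b i).
  move=> F0; rewrite (bigID (fun i : 'I_n => i < m)%N) /= (big_ord_narrow lemn).
  rewrite [X in op _ X]big1 ?Monoid.mulm1 => [|i nltim]; last first.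
    by rewrite mnmE insubN.
  by apply: eq_bigr => i _; rewrite mnmE /= valK.
by rewrite HE !mdegE (splitE _ _ _ id) // splitE.
Qed.

End Stability.

(** * The Todd and L series *)

Section PowerSeriesTheory.
Variable R : comUnitRingType.
Implicit Types a b c : nat -> R.

Lemma eq_ps_mul a a' b b' : a =1 a' -> b =1 b' -> ps_mul a b =1 ps_mul a' b'.
Proof. by move=> ea eb k; apply: eq_bigr => i _; rewrite ea eb. Qed.

(** Only terms below N matter, so series identities reduce to the ring laws of polynomials. *)
Lemma coefM_poly_trunc N a b k : (k < N)%N ->
  ps_mul a b k = (\poly_(i < N) a i * \poly_(i < N) b i)`_k.
Proof.
move=> ltkN; rewrite coefM; apply: eq_bigr => i _; rewrite !coef_poly.
by rewrite (leq_ltn_trans (leq_subr i k) ltkN) (leq_ltn_trans (leq_ord i) ltkN).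
Qed.

Lemma ps_mulC a b : ps_mul a b =1 ps_mul b a.
Proof. by move=> k; rewrite !(coefM_poly_trunc _ _ (ltnSn k)) mulrC. Qed.

Lemma ps_mulA a b c : ps_mul a (ps_mul b c) =1 ps_mul (ps_mul a b) c.
Proof.
move=> k; pose t x : {poly R} := \poly_(i < k.+1) x i.
transitivity ((t a * (t b * t c))`_k).
  rewrite coefM; apply: eq_bigr => i _; rewrite coef_poly ltn_ord.
  by rewrite (coefM_poly_trunc (N := k.+1)) // ltnS leq_subr.
rewrite mulrA coefM; apply: eq_bigr => i _; rewrite coef_poly ltnS leq_subr.
by rewrite (coefM_poly_trunc (N := k.+1)).
Qed.

Lemma ps_mul1 a : ps_mul a (fun k => (k == 0%N)%:R) =1 a.
Proof.
move=> k; rewrite /ps_mul big_ord_recr /= subnn mulr1 big1 ?add0r // => i _.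
by rewrite subn_eq0 leqNgt ltn_ord mulr0.
Qed.

Lemma ps_mulDl a a' b k :
  ps_mul (fun i => a i + a' i) b k = ps_mul a b k + ps_mul a' b k.
Proof. by rewrite -big_split; apply: eq_bigr => i _; rewrite mulrDl. Qed.

Lemma ps_mul_geom x a b k :
  ps_mul (fun i => x ^+ i * a i) (fun i => x ^+ i * b i) k =
  x ^+ k * ps_mul a b k.
Proof.
rewrite [RHS]mulr_sumr; apply: eq_bigr => i _.
by rewrite mulrACA -exprD subnKC // leq_ord.
Qed.

(** The series a(x^2); it turns series in z = x^2, such as [L_series], into series in x. *)
Definition ps_sqr a (k : nat) : R := if odd k then 0 else a k./2.

Lemma ps_mul_sqr a b : ps_mul (ps_sqr a) (ps_sqr b) =1 ps_sqr (ps_mul a b).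
Proof.
move=> k; pose t x : {poly R} := \poly_(i < k.+1) x i.
have tE x i : (i <= k)%N -> ps_sqr x i = (t x \Po 'X^2)`_i.
  move=> leik; rewrite coef_comp_poly_Xn // dvdn2 coef_poly /ps_sqr divn2.
  case: (odd i) => //=; rewrite ifT //; lia.
transitivity ((t a * t b \Po 'X^2)`_k); last first.
  rewrite coef_comp_poly_Xn // dvdn2 /ps_sqr; case: (odd k) => //=.
  by rewrite -(coefM_poly_trunc (N := k.+1)) ?divn2 //; lia.
rewrite comp_polyM coefM; apply: eq_bigr => i _.
by rewrite !tE ?leq_subr // leq_ord.
Qed.

Lemma ps_inv_unique a a' b : ps_mul a b =1 (fun k => (k == 0%N)%:R) ->
  ps_mul a' b =1 (fun k => (k == 0%N)%:R) -> a =1 a'.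
Proof.
move=> ab a'b k.
rewrite -[LHS]ps_mul1 -(eq_ps_mul (frefl a) a'b) ps_mulA.
rewrite (eq_ps_mul (ps_mulC a a') (frefl b)) -ps_mulA.
by rewrite (eq_ps_mul (frefl a') ab) ps_mul1.
Qed.

End PowerSeriesTheory.

Lemma natrf_neq0 k : k`!%:R != 0 :> rat.
Proof. by rewrite pnatr_eq0 -lt0n fact_gt0. Qed.

(** Reduces products of exponential-type series to the binomial theorem. *)
Lemma sum_bin_div (F : nat -> rat) k :
  \sum_(i < k.+1) F i * (i`!%:R)^-1 * ((k - i)`!%:R)^-1 =
  (k`!%:R)^-1 * \sum_(i < k.+1) F i *+ 'C(k, i).
Proof.
rewrite mulr_sumr; apply: eq_bigr => i _.
have lik : (i <= k)%N by rewrite leq_ord.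
rewrite -(bin_fact lik) !natrM -mulr_natr.
have b0 : 'C(k, i)%:R != 0 :> rat by rewrite pnatr_eq0 -lt0n bin_gt0.
have := natrf_neq0 i; have := natrf_neq0 (k - i); move: b0.
by move=> ? ? ?; field; apply/and3P.
Qed.

Definition exp_series (x : rat) (k : nat) : rat := x ^+ k / k`!%:R.

(** This is e^(-z) e^z = 1, read off from (1 - 1)^k. *)
Lemma exp_series_mulVN k :
  ps_mul (exp_series (- 1)) (exp_series 1) k = (k == 0%N)%:R.
Proof.
rewrite /ps_mul /exp_series; under eq_bigr do rewrite expr1n mul1r.
rewrite sum_bin_div.
have := exprDn (1 : rat) (-1) k; rewrite addrN expr0n.
under eq_bigr do rewrite expr1n mul1r.
by move=> <-; case: k => [|k]; rewrite ?mulr0 // mulr1 invr1.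
Qed.

(** The series sinh x / x, the denominator of x coth x. *)
Definition sinh_series : nat -> rat := ps_sqr (fun k => ((2 * k)%N.+1`!%:R)^-1).

Lemma sinh_seriesE k : sinh_series k = (1 + (-1) ^+ k) / 2%:R / k.+1`!%:R.
Proof.
rewrite /sinh_series /ps_sqr -signr_odd; have := odd_double_half k.
case: (odd k) => /= ek; first by rewrite expr1 addrN !mul0r.
by rewrite expr0 (_ : 2 * k./2 = k)%N ?divff ?mul1r //; lia.
Qed.

Lemma cosh_seriesE k :
  ps_sqr (fun i => ((2 * i)%N`!%:R)^-1 : rat) k =
  (1 + (-1) ^+ k) / 2%:R / k`!%:R.
Proof.
rewrite /ps_sqr -signr_odd; have := odd_double_half k.
case: (odd k) => /= ek; first by rewrite expr1 addrN !mul0r.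
by rewrite expr0 (_ : 2 * k./2 = k)%N ?divff ?mul1r //; lia.
Qed.

(** This is e^x (sinh x / x) = (e^(2x) - 1) / (2x). *)
Lemma exp_mul_sinh k :
  ps_mul (exp_series 1) sinh_series k = 2%:R ^+ k / k.+1`!%:R.
Proof.
pose F i : rat := (1 - (-1) ^+ (k.+1 - i)) / 2%:R.
(* Completing the binomial row k + 1 adds the term i = k + 1, where [F] vanishes. *)
transitivity (\sum_(i < k.+2) F i * (i`!%:R)^-1 * ((k.+1 - i)`!%:R)^-1).
  rewrite [RHS]big_ord_recr /= {2}/F subnn subrr !mul0r addr0.
  apply: eq_bigr => i _; rewrite /exp_series expr1n mul1r sinh_seriesE.
  rewrite /F subSn ?leq_ord // exprS mulN1r opprK; ring.
rewrite sum_bin_div mulrC; congr (_ / _).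
(* Twice the binomial sum of [F] is (1 + 1)^(k + 1) - (-1 + 1)^(k + 1). *)
have E1 := exprDn (1 : rat) 1 k.+1; have E2 := exprDn (-1 : rat) 1 k.+1.
have {E1} E1 : 2%:R ^+ k.+1 = \sum_(i < k.+2) (1 : rat) *+ 'C(k.+1, i).
  rewrite -[2%:R]/(1 + 1) E1; apply: eq_bigr => i _; by rewrite !expr1n mulr1.
have {E2} E2 : 0 = \sum_(i < k.+2) (-1 : rat) ^+ (k.+1 - i) *+ 'C(k.+1, i).
  move: E2; rewrite addNr expr0n => /esym E2; rewrite -[LHS]E2.
  apply: eq_bigr => i _.
  by rewrite expr1n mulr1.
apply: (@mulfI _ 2%:R) => //; rewrite -exprS -[RHS]subr0 [in RHS]E2 E1.
rewrite -sumrB mulr_sumr; apply: eq_bigr => i _.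
by rewrite /F -mulrnBl mulrnAr mulrC divfK.
Qed.

(** This is (x coth x) (sinh x / x) = cosh x. *)
Lemma L_sinh k :
  ps_mul (ps_sqr L_series) sinh_series k =
  ps_sqr (fun i => ((2 * i)%N`!%:R)^-1) k.
Proof.
rewrite /sinh_series ps_mul_sqr /ps_sqr; case: (odd k) => //.
rewrite /L_series -ps_mulA (eq_ps_mul (frefl _) (ps_mulC _ _)).
rewrite -[RHS](ps_mul1 (fun i => ((2 * i)%N`!%:R)^-1) k./2).
apply: eq_ps_mul => // i.
by rewrite ps_mulV // unitfE natrf_neq0.
Qed.

(* In terms of x: x coth x - x = 2x / (e^(2x) - 1), as both sides become
   e^(-x) on multiplication by sinh x / x. *)
Lemma L_todd_series k :
  2%:R ^+ k * todd_series k = ps_sqr L_series k - (k == 1%N)%:R.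
Proof.
(* [D] is (e^(2x) - 1) / (2x); [A], which is 2x / (e^(2x) - 1), and [B], which is x coth x - x, are
   both inverse to it. *)
pose D i : rat := 2%:R ^+ i / i.+1`!%:R.
pose A i : rat := 2%:R ^+ i * todd_series i.
pose B i : rat := ps_sqr L_series i - (i == 1%N)%:R.
have AD : ps_mul A D =1 (fun k => (k == 0%N)%:R).
  move=> i; rewrite ps_mul_geom ps_mulC.
  rewrite ps_mulV ?unitfE ?invr_eq0 ?natrf_neq0 //.
  by case: i => [|i]; rewrite ?mulr0 // mulr1 expr0.
suff BD : ps_mul B D =1 (fun k => (k == 0%N)%:R).
  exact: (ps_inv_unique AD BD).
have BS : ps_mul B sinh_series =1 exp_series (-1).
  move=> i; rewrite /B (ps_mulDl _ (fun i => - (i == 1%N)%:R)) L_sinh.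
  have -> : ps_mul (fun i => - (i == 1%N)%:R) sinh_series i =
            if i is j.+1 then - sinh_series j else 0.
    rewrite /ps_mul; case: i => [|i]; first by rewrite big_ord1 oppr0 mul0r.
    rewrite big_ord_recl (bigD1 ord0) //= big1 => [|j].
      by rewrite oppr0 mul0r add0r addr0 subSS subn0 mulN1r.
    by rewrite -lt0n; case: j => [[|j] ?] //= _; rewrite oppr0 mul0r.
  rewrite cosh_seriesE /exp_series; case: i => [|i].
    by rewrite addr0 expr0 divff.
  by rewrite sinh_seriesE exprS; have := natrf_neq0 i.+1 => ?; field.
move=> i; rewrite -(eq_ps_mul (frefl B) exp_mul_sinh).
rewrite (eq_ps_mul (frefl B) (ps_mulC _ _)) ps_mulA.
by rewrite (eq_ps_mul BS (frefl _)) exp_series_mulVN.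
Qed.

(** * Chern numbers in terms of the Chern roots *)

Section PontryaginRoots.
Variables (R : comNzRingType) (n : nat).

Definition sqr_vars : n.-tuple {mpoly R[n]} := [tuple 'X_i ^+ 2 | i < n].

(** Folding about the middle term gives the shape in which the Pontryagin classes are defined. *)
Lemma sum_sym_nat (A : nmodType) i (F : nat -> A) :
  \sum_(j < (2 * i).+1) F j =
  F i + \sum_(1 <= j < i.+1) (F (i - j)%N + F (i + j)%N).
Proof.
have lt2i : (i < (2 * i).+1)%N by lia.
rewrite -(big_mkord xpredT) (big_cat_nat (n := i)) ?(ltnW lt2i) //=.
rewrite [X in _ + X]big_ltn // addrCA; congr (_ + _).
rewrite big_split; congr (_ + _).
  by rewrite big_nat_rev big_add1 add0n.
rewrite -[i.+1]add1n big_addn (_ : (2 * i).+1 - i = i.+1)%N; last by lia.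
by apply: eq_bigr => j _; rewrite addnC.
Qed.

(** With E(X) the product of the 1 + x_j X, compare X^(2i) in E(X) E(-X) = prod (1 - x_j^2 X^2): up
    to the sign (-1)^i, the left side folds into the formula for p_i and the right side is e_i of
    the squares. *)
Lemma mesym_sqr_vars i :
  mesym n R i \mPo sqr_vars = mesym n R i ^+ 2 +
    \sum_(1 <= j < i.+1)
       ((-1) ^+ j * 2%:R) *: (mesym n R (i - j) * mesym n R (i + j)).
Proof.
pose E (z : 'I_n -> {mpoly R[n]}) := \prod_(j < n) (1 + z j *: 'X).
have EN z k : (E (fun j => - z j))`_k = (-1) ^+ k * (E z)`_k.
  rewrite !coef_prod_1addZX mulr_sumr; apply: eq_bigr => h /eqP hk.
  by rewrite prodrN hk.
have e1 : E (fun j => 'X_j) * E (fun j => - 'X_j) =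
          E (fun j => - 'X_j ^+ 2) \Po 'X^2.
  rewrite rmorph_prod -big_split; apply: eq_bigr => j _ /=.
  rewrite comp_polyD comp_polyC comp_polyZ comp_polyX -!mul_polyC polyCN polyCN.
  rewrite rmorphXn /=; ring.
have eE k : (E (fun j => 'X_j))`_k = mesym n R k by rewrite coef_prod_1addZX.
have := congr1 (fun p : {poly _} => p`_(2 * i)) e1.
rewrite coef_comp_poly_Xn // dvdn_mulr // mulKn // EN coefM.
under eq_bigr do rewrite EN !eE.
rewrite (sum_sym_nat i (fun k => mesym n R k *
           ((-1) ^+ (2 * i - k) * mesym n R (2 * i - k)))) => e2.
apply: (can_inj (signrMK i)).
rewrite /= mulrDr; transitivity ((-1) ^+ i * (E (fun j => 'X_j ^+ 2))`_i).
  congr (_ * _); rewrite coef_prod_1addZX /mesym raddf_sum /=.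
  apply: eq_bigr => h _; rewrite rmorph_prod /=; apply: eq_bigr => j _.
  by rewrite comp_mpolyXU -tnth_nth tnth_mktuple.
rewrite -e2 (_ : 2 * i - i = i)%N; last by lia.
congr (_ + _); first by rewrite mulrCA expr2.
rewrite mulr_sumr; apply: eq_big_nat => j /andP[_ ltji].
rewrite (_ : 2 * i - (i - j) = i + j)%N; last by lia.
rewrite (_ : 2 * i - (i + j) = i - j)%N; last by lia.
have -> : (-1) ^+ (i - j) = (-1) ^+ i * (-1) ^+ j :> {mpoly R[n]}.
  by rewrite -exprD -signr_odd oddB // -oddD signr_odd.
rewrite exprD -mul_mpolyC mpolyCM rmorphXn /= mpolyCN mpolyC1.
rewrite (_ : (2%:R)%:MP = 2%:R) ?mpolyC_nat //; ring.
Qed.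

Lemma mcoeff_comp_sqr (g : {mpoly R[n]}) (a : 'X_{1..n}) :
  (g \mPo sqr_vars)@_a =
  if [forall i, ~~ odd (a i)] then g@_[multinom (a i)./2 | i < n] else 0.
Proof.
elim/mpolyind: g => [|c b p _ _ IHp].
  by rewrite linear0 !mcoeff0 if_same.
rewrite linearP /= !mcoeffD !mcoeffZ IHp mcoeffX.
have -> : 'X_[b] \mPo sqr_vars = 'X_[(b *+ 2)%MM].
  rewrite comp_mpolyX mpolyXE_id; apply: eq_bigr => i _.
  by rewrite tnth_mktuple -exprM mulmnE mulnC.
rewrite mcoeffX; case: ifPn => [/forallP ea|/forallPn[i]].
  congr (c * (nat_of_bool _)%:R + _).
  apply/eqP/eqP => [<-|eb]; apply/mnmP => i.
    by rewrite mnmE mulmnE muln2 doubleK.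
  by rewrite eb mulmnE mnmE muln2 even_halfK.
rewrite negbK => oi; case: eqP => [eb|]; last by rewrite mulr0 addr0.
by move: oi; rewrite -eb mulmnE muln2 odd_double.
Qed.

End PontryaginRoots.

Section ChernRoots.
Variable n : nat.

(** The symmetric polynomial in the Chern roots; the parity argument compares the coefficients of
    its monomials. *)
Definition chern_roots (u : chern_numbers n) : {mpoly rat[n]} :=
  chern_poly u \mPo [tuple mesym n rat i.+1 | i < n].

Lemma chern_roots_linear : linear chern_roots.
Proof. by move=> c u v; rewrite /chern_roots -linearP. Qed.

HB.instance Definition _ :=
  GRing.isLinear.Build rat (chern_numbers n) {mpoly rat[n]} _ chern_roots
    chern_roots_linear.

Lemma mcoeff_chern_rootsZ c u a :
  (chern_roots (c *: u))@_a = c * (chern_roots u)@_a.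
Proof. by rewrite -mcoeffZ; congr (_@__); exact: linearZ. Qed.

Lemma mcoeff_chern_rootsD u v a :
  (chern_roots (u + v))@_a = (chern_roots u)@_a + (chern_roots v)@_a.
Proof. by rewrite (raddfD chern_roots) mcoeffD. Qed.

Lemma mcoeff_chern_roots_sum (I : finType) (c : I -> rat) F a :
  (chern_roots (\sum_i c i *: F i))@_a = \sum_i c i * (chern_roots (F i))@_a.
Proof.
rewrite (raddf_sum chern_roots) raddf_sum; apply: eq_bigr => i _.
exact: mcoeff_chern_rootsZ.
Qed.

(** Algebraic independence of the elementary symmetric polynomials. *)
Lemma chern_roots_inj : injective chern_roots.
Proof. by move=> u v /msym_fundamental_un /val_inj. Qed.

Lemma chern_roots_homog u : chern_roots u \is n.-homog.
Proof. by rewrite -mwmwgt_homogE; exact: (valP u). Qed.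

Lemma chern_class_roots k :
  chern_class n k \mPo [tuple mesym n rat i.+1 | i < n] = mesym n rat k.
Proof.
case: k => [|k]; first by rewrite comp_mpoly1 mesym0E.
rewrite /=; case: insubP => [i _ <-|] /=.
  by rewrite comp_mpolyXU -tnth_nth tnth_mktuple.
by rewrite linear0 -leqNgt => lenk; rewrite mesym_geqnE.
Qed.

Lemma pontryagin_class_roots i :
  pontryagin_class n i \mPo [tuple mesym n rat i.+1 | i < n] =
  mesym n rat i \mPo sqr_vars rat n.
Proof.
rewrite mesym_sqr_vars rmorphD rmorphXn /= chern_class_roots raddf_sum /=.
congr (_ + _); apply: eq_bigr => j _.
by rewrite linearZ rmorphM /= !chern_class_roots.
Qed.

End ChernRoots.

Lemma pontryagin_subst_roots m (f : {mpoly rat[m]}) :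
  pontryagin_subst f \mPo [tuple mesym (2 * m) rat i.+1 | i < 2 * m] =
  (f \mPo [tuple mesym (2 * m) rat i.+1 | i < m]) \mPo sqr_vars rat (2 * m).
Proof.
rewrite /pontryagin_subst comp_mpolyA [RHS]comp_mpolyA.
apply: (congr1 (fun t => f \mPo t)); apply: eq_from_tnth => i.
apply: etrans (tnth_mktuple _ _) _; apply: etrans _ (esym (tnth_mktuple _ _)).
apply: (etrans (congr1 _ (tnth_mktuple _ _))).
apply: (etrans _ (esym (congr1 _ (tnth_mktuple _ _)))).
exact: pontryagin_class_roots.
Qed.

(** * Parity of the exponents *)

(** The index s of the parity sector of the monomial. *)
Definition odd_exps n (a : 'X_{1..n}) : nat := \sum_(i < n) odd (a i).

(* Even k: the coefficient of z^k in (z / 2) coth (z / 2). Odd k: 1 only for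
   k = 1, marking the linear term x (1 - y) / 2 of Q. *)
Definition even_todd (k : nat) : rat :=
  if odd k then (k == 1%N)%:R else todd_series k.

(** In degree n, the coefficient of [a] in F_s with s = [odd_exps a]. *)
Definition genus_coef n (a : 'X_{1..n}) : rat := \prod_(i < n) even_todd (a i).

(** The factor of F_s in T_n(y). *)
Definition parity_poly n s : {poly rat} :=
  (2%:R^-1 *: (1 - 'X)) ^+ s * ('X + 1) ^+ (n - s).

Lemma L_series0 : L_series 0 = 1.
Proof.
have := L_sinh 0; rewrite /ps_mul big_ord1 sinh_seriesE cosh_seriesE.
by rewrite /ps_sqr /= expr0 divff // mulr1.
Qed.

(** The x^2 coefficients in (x coth x) (sinh x / x) = cosh x give 1/6 + L_1 = 1/2. *)
Lemma L_series1 : L_series 1 = 3%:R^-1.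
Proof.
have s0 : sinh_series 0 = 1 by rewrite sinh_seriesE; apply/eqP.
have s2 : sinh_series 2 = 6%:R^-1 by rewrite sinh_seriesE; apply/eqP.
have c2 : ps_sqr (fun i => ((2 * i)%N`!%:R)^-1) 2 = 2%:R^-1 :> rat.
  by rewrite cosh_seriesE; apply/eqP.
have := L_sinh 2; rewrite c2 /ps_mul !big_ord_recr big_ord0 /= s0 s2.
rewrite /ps_sqr /= L_series0 mul0r => e; lra.
Qed.

(** With E(z) = (z / 2) coth (z / 2), this is E(2x) = x coth x. *)
Lemma even_todd_L k : ~~ odd k -> 2%:R ^+ k * even_todd k = L_series k./2.
Proof.
move=> ek; rewrite /even_todd (negPf ek) L_todd_series /ps_sqr (negPf ek).
by case: eqP ek => [->|_] //; rewrite subr0.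
Qed.

Lemma Q_series_parity k :
  Q_series k = even_todd k *:
    ((2%:R^-1 *: (1 - 'X)) ^+ odd k * ('X + 1) ^+ (k - odd k)).
Proof.
rewrite /Q_series /even_todd; have [ok|ek] := boolP (odd k) => /=; last first.
  by rewrite expr0 mul1r subn0; case: eqP ek => [->|] //; rewrite add0r.
have := L_todd_series k; rewrite /ps_sqr ok sub0r; case: eqP => [->|_] e.
  (* For k = 1 the identity is 1 - (y + 1) / 2 = (1 - y) / 2. *)
  have -> : todd_series 1 = - 2%:R^-1 by move: e => /=; rewrite expr1; lra.
  rewrite !scale1r !expr1 subnn expr0 mulr1.
  rewrite -!mul_polyC polyCN; have : (2%:R^-1)%:P * 2%:R = 1 :> {poly rat}.
    by rewrite -polyC_natr -polyCM mulVf.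
  set h := (_)%:P => h2; rewrite -{1}[1%:R]h2; ring.
(* For odd k >= 3 the Todd coefficient vanishes, since x coth x is even. *)
have/eqP := e; rewrite oppr0 mulf_eq0 expf_eq0 pnatr_eq0 andbF /= => /eqP ->.
by rewrite !scale0r addr0.
Qed.

Lemma leq_odd_exps n (a : 'X_{1..n}) : (odd_exps a <= mdeg a)%N.
Proof.
by rewrite mdegE; apply: leq_sum => i _; case: (a i) => // k; case: odd.
Qed.

(** Each odd exponent trades one factor 1 + y for (1 - y) / 2, and the exponents add up to n. *)
Lemma prod_Q_series n (a : 'X_{1..n}) : mdeg a = n ->
  \prod_(i < n) Q_series (a i) = genus_coef a *: parity_poly n (odd_exps a).
Proof.
move=> dega; under eq_bigr do rewrite Q_series_parity.
rewrite scaler_prod big_split /= !prodrXr /parity_poly sumnB.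
  by rewrite -mdegE dega.
by move=> i _; case: (a i) => // k; case: odd.
Qed.

(** Ensures that the coefficients of y^0, ..., y^n suffice to evaluate T_n(y). *)
Lemma size_parity_poly n s : (s <= n)%N -> (size (parity_poly n s) <= n.+1)%N.
Proof.
move=> lesn; rewrite /parity_poly exprZn -scalerAl.
apply: leq_trans (size_scale_leq _ _) _; apply: leq_trans (size_polyMleq _ _) _.
have size1 : size (1 - 'X : {poly rat}) = 2%N.
  by rewrite -size_polyN opprB size_XsubC.
have size2 : size ('X + 1 : {poly rat}) = 2%N by rewrite size_XaddC.
have := size_poly_exp_leq (1 - 'X : {poly rat}) s.
have := size_poly_exp_leq ('X + 1 : {poly rat}) (n - s).
rewrite size1 size2 !mul1n => le2 le1.
apply: (@leq_trans (s.+1 + (n - s).+1).-1); last by lia.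
by rewrite -!subn1; apply/leq_sub2r/leq_add.
Qed.

Lemma horner_parity_poly n s x :
  (parity_poly n s).[x] = (2%:R^-1 * (1 - x)) ^+ s * (x + 1) ^+ (n - s).
Proof. by rewrite /parity_poly hornerM !horner_exp hornerZ !hornerE. Qed.

(** * Sector coefficients of the Todd, Euler, signature and Pontryagin numbers *)

Section ToddRoots.
Variable n : nat.

(** Taking the coefficient of y^p is not multiplicative, but it commutes with substituting
    elementary symmetric polynomials, whose coefficients are constant in y. *)
Lemma map_coefp_comp (R : idomainType) p k (f : {mpoly {poly R}[k]}) :
  map_mpoly (coefp p) f \mPo [tuple mesym n R i.+1 | i < k] =
  map_mpoly (coefp p) (f \mPo [tuple mesym n {poly R} i.+1 | i < k]).
Proof.
elim/mpolyind: f => [|c a f _ _ IHf]; first by rewrite !raddf0.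
rewrite !raddfD /= IHf; congr (_ + _).
have -> : map_mpoly (coefp p) (c *: 'X_[a]) = c`_p *: 'X_[a].
  apply/mpolyP => d; rewrite mcoeff_map_mpoly !mcoeffZ !mcoeffX /=.
  by rewrite -polyC_natr coefMC.
rewrite !linearZ /= (_ : 'X_[a] \mPo _ =
          map_mpoly polyC ('X_[a] \mPo [tuple mesym n R i.+1 | i < k])).
  apply/mpolyP => b; rewrite (mcoeff_map_mpoly (coefp p)) !mcoeffZ.
  by rewrite mcoeff_map_mpoly /= coefMC.
rewrite !comp_mpolyX rmorph_prod; apply: eq_bigr => i _ /=.
rewrite rmorphXn /= !tnth_mktuple; congr (_ ^+ _).
by apply/mpolyP => d; rewrite mcoeff_map_mpoly !mcoeff_mesym /= polyC_natr.
Qed.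

Lemma mcoeff_todd_number p (a : 'X_{1..n}) : mdeg a = n ->
  (chern_roots (todd_number n p))@_a =
  genus_coef a * (parity_poly n (odd_exps a))`_p.
Proof.
move=> dega; rewrite /chern_roots /= map_coefp_comp multseqE.
by rewrite mcoeff_map_mpoly /= mcoeff_genus_part dega eqxx prod_Q_series // coefZ.
Qed.

End ToddRoots.

(** Each parity is at most its exponent, with equality exactly for exponents 0 and 1; the exponents
    sum to n. *)
Lemma odd_exps_eq n (a : 'X_{1..n}) : mdeg a = n ->
  (odd_exps a == n) = [forall i, a i <= 1]%N.
Proof.
move=> dega.
have := @leqif_sum 'I_n xpredT (fun i => a i <= 1)%N (fun i => odd (a i)) a.
rewrite -mdegE dega => h; apply h => i _; split.
  by case: (a i) => // k; case: odd.
by case: (a i) => [|[|k]] //=; case: odd.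
Qed.

Lemma genus_coef_odd n (a : 'X_{1..n}) : mdeg a = n -> odd_exps a = n ->
  genus_coef a = 1.
Proof.
move=> /odd_exps_eq + on; rewrite on eqxx => /esym/forallP a1.
rewrite /genus_coef big1 // => i _; move: (a1 i).
case: (a i) => [|[|]] //= _.
by have := even_todd_L (isT : ~~ odd 0); rewrite mul1r L_series0.
Qed.

Lemma mcoeff_euler n (a : 'X_{1..n}) : mdeg a = n ->
  (chern_roots (euler n))@_a = (odd_exps a == n)%:R.
Proof.
move=> dega; rewrite /chern_roots /= chern_class_roots mcoeff_mesym.
by rewrite /mechar dega eqxx odd_exps_eq.
Qed.

(** The signature is 2^(2m) F_0: stability evaluates L_m on the 2m squared roots, and [even_todd_L]
    converts each factor, with 2^(2m) split as the product of the 2^(a i). *)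
Lemma mcoeff_signature m (a : 'X_{1..2 * m}) : mdeg a = (2 * m)%N ->
  (chern_roots (signature m))@_a =
  if odd_exps a == 0%N then 2%:R ^+ (2 * m) * genus_coef a else 0.
Proof.
move=> dega; rewrite /chern_roots /= pontryagin_subst_roots mcoeff_comp_sqr.
have -> : (odd_exps a == 0%N) = [forall i, ~~ odd (a i)].
  by rewrite sum_nat_eq0; apply: eq_forallb => i; rewrite eqb0.
case: ifP => // /forallP ea.
rewrite mcoeff_multseq_mesym ?L_series0 //; last first.
  by rewrite leq_pmull.
have -> : 2%:R ^+ (2 * m) = \prod_(i < 2 * m) 2%:R ^+ a i :> rat.
  by rewrite prodrXr -mdegE dega.
rewrite -big_split /= ifT.
  by apply: eq_bigr => i _; rewrite mnmE even_todd_L.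
apply/eqP/double_inj; rewrite -[RHS]mul2n -[RHS]dega !mdegE -mul2n.
rewrite big_distrr /=; apply: eq_bigr => i _.
by rewrite mnmE mul2n even_halfK.
Qed.

Lemma mcoeff_pontryagin_number m (p : pontryagin_index m) (a : 'X_{1..2 * m}) :
  odd_exps a != 0%N -> (chern_roots (pontryagin_number p))@_a = 0.
Proof.
rewrite sum_nat_eq0 => /forallPn[i]; rewrite eqb0 => oi.
rewrite /chern_roots /= pontryagin_subst_roots mcoeff_comp_sqr ifN //.
by apply/forallPn; exists i.
Qed.

(** * Spans and the intersection of EP and HT *)

Lemma span_image_sum (K : fieldType) (vT : vectType K) (I : finType)
    (F : I -> vT) v : v \in <<[seq F i | i : I]>>%VS ->
  exists c : I -> K, v = \sum_i c i *: F i.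
Proof.
rewrite span_def big_image => /memv_sumP[w wF ->].
have /fin_all_exists[c wc] i : exists c, w i = c *: F i.
  by apply/vlineP; apply: wF.
by exists c; apply: eq_bigr => i _; rewrite wc.
Qed.

Lemma sum_span_image (K : fieldType) (vT : vectType K) (I : finType)
    (F : I -> vT) (c : I -> K) : \sum_i c i *: F i \in <<[seq F i | i : I]>>%VS.
Proof.
by apply: memv_suml => i _; apply/memvZ/memv_span/image_f.
Qed.

Section Intersection.
Variable m : nat.
Let n := (2 * m)%N.

Lemma chern_roots_eq (u v : chern_numbers n) :
  (forall a, mdeg a = n -> (chern_roots u)@_a = (chern_roots v)@_a) -> u = v.
Proof.
move=> uv; apply: chern_roots_inj; apply/mpolyP => a.
have [/uv //|dega] := eqVneq (mdeg a) n.
by rewrite !(dhomog_nemf_coeff (chern_roots_homog _)).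
Qed.

(** Containment of HT in the span of the F_s: apart from [genus_coef a], the coefficient depends on
    [a] only through its sector. *)
Lemma mcoeff_HT (c : 'I_n.+1 -> rat) (a : 'X_{1..n}) : mdeg a = n ->
  (chern_roots (\sum_(p < n.+1) c p *: todd_number n p))@_a =
  genus_coef a * \sum_(p < n.+1) (parity_poly n (odd_exps a))`_p * c p.
Proof.
move=> dega; rewrite mcoeff_chern_roots_sum mulr_sumr; apply: eq_bigr => p _.
by rewrite mcoeff_todd_number // mulrC mulrA.
Qed.

Lemma todd_sum_horner (x : rat) (a : 'X_{1..n}) : mdeg a = n ->
  (chern_roots (\sum_(p < n.+1) x ^+ p *: todd_number n p))@_a =
  genus_coef a * (parity_poly n (odd_exps a)).[x].
Proof.
move=> dega; rewrite mcoeff_HT // (@horner_coef_wide _ n.+1) //.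
by rewrite size_parity_poly // -{2}dega leq_odd_exps.
Qed.

(** At y = 1 the factor (1 - y) / 2 kills every sector but s = 0, where 2^n remains. *)
Lemma signature_todd :
  signature m = \sum_(p < n.+1) 1 ^+ p *: todd_number n p.
Proof.
apply: chern_roots_eq => a dega; rewrite todd_sum_horner // mcoeff_signature //.
rewrite horner_parity_poly subrr mulr0 expr0n.
case: eqP => [->|_]; last by rewrite mul0r mulr0.
by rewrite mul1r subn0 mulrC.
Qed.

(** At y = -1 the factor 1 + y kills every sector but s = n, where (1 - y) / 2 = 1. *)
Lemma euler_todd :
  euler n = \sum_(p < n.+1) (-1) ^+ p *: todd_number n p.
Proof.
apply: chern_roots_eq => a dega; rewrite todd_sum_horner // mcoeff_euler //.
rewrite horner_parity_poly opprK addNr mulVf // expr1n mul1r expr0n.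
rewrite subn_eq0; have := leq_odd_exps a; rewrite dega => le.
rewrite [(n <= _)%N](_ : _ = (odd_exps a == n)); last by rewrite eqn_leq le.
by case: eqP => [/genus_coef_odd ->|_]; rewrite ?mulr1 ?mulr0.
Qed.

Lemma signature_EP : signature m \in EP m.
Proof.
apply: (subvP (addvSr _ _)).
pose f := multseq L_series m.
suff -> : signature m = \sum_(a : pontryagin_index m)
                           f@_(val (val a)) *: pontryagin_number a.
  exact: sum_span_image.
apply: val_inj; rewrite raddf_sum /= /pontryagin_subst -/f.
(* Expand L_m into monomials of degree at most m; homogeneity leaves those of weight m, each giving
   a Pontryagin number. *)
rewrite (@comp_mpolywE _ _ _ _ _ m.+1).
  rewrite (bigID (fun a : 'X_{1..m < m.+1} => mnmwgt a == m)) /=.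
  rewrite [X in _ + X]big1 => [|a na]; last first.
    by rewrite (dhomog_nemf_coeff (multseq_homog _ _) na) scale0r.
  rewrite addr0 (big_sub (fun a : 'X_{1..m < m.+1} => mnmwgt a == m)).
  by apply: eq_bigr => a _; rewrite /= -comp_mpolyX.
rewrite msizeE; apply/bigmax_leqP_seq => b fb _; rewrite ltnS.
have /dhomogP/(_ b fb) {2}<- := multseq_homog L_series m.
exact: leq_mdeg_mnmwgt.
Qed.

Hypothesis m_gt0 : (0 < m)%N.

Lemma cap_EP_HT u : u \in (EP m :&: HT m)%VS ->
  exists x y, u = x *: euler n + y *: signature m.
Proof.
rewrite memv_cap => /andP[].
case/memv_addP => _ /vlineP[k ->] [_ /span_image_sum[d ->] ue].
case/span_image_sum => c uc.
(* [w s] is the multiple of F_s contained in [u]. *)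
pose w s := \sum_(p < n.+1) (parity_poly n s)`_p * c p.
(* The Euler number is F_n and the signature is 2^n F_0, whence the division. *)
exists (w n), (w 0%N / 2%:R ^+ n); apply: chern_roots_eq => a dega.
rewrite mcoeff_chern_rootsD !mcoeff_chern_rootsZ mcoeff_euler //.
rewrite mcoeff_signature //.
have uca : (chern_roots u)@_a = genus_coef a * w (odd_exps a).
  by rewrite uc mcoeff_HT.
have [s0|s0] := eqVneq (odd_exps a) 0%N.
  (* As n > 0, the Euler number does not meet sector 0. *)
  rewrite s0 eq_sym (_ : n == 0%N = false) ?mulr0 ?add0r.
    by rewrite uca s0 mulrA divfK 1?mulrC // expf_neq0.
  by rewrite /n; lia.
rewrite mulr0 addr0; have [sn|sn] := eqVneq (odd_exps a) n.
  by rewrite uca sn genus_coef_odd // mulrC.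
(* In the sectors 0 < s < n, membership in EP makes the coefficient vanish. *)
rewrite ue mcoeff_chern_rootsD mcoeff_chern_rootsZ mcoeff_euler // (negPf sn).
rewrite !mulr0 add0r mcoeff_chern_roots_sum big1 // => p _.
by rewrite mcoeff_pontryagin_number ?mulr0.
Qed.

Lemma signature_neq0 : signature m != 0.
Proof.
(* The monomial x_1^2 ... x_m^2 has only nonzero factors, coming from L_1 = 1/3 and L_0 = 1. *)
pose a : 'X_{1..n} := [multinom (if (i < m)%N then 2 else 0)%N | i < n].
have lemn : (m <= n)%N by rewrite leq_pmull.
have dega : mdeg a = n.
  rewrite mdegE; under eq_bigr do rewrite mnmE.
  rewrite -big_mkcond /= (big_ord_narrow lemn) sum_nat_const.
  by rewrite card_ord mulnC.
have ea i : ~~ odd (a i) by rewrite mnmE; case: ifP.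
apply/eqP => /(congr1 (fun u => (chern_roots u)@_a)).
rewrite (raddf0 (@chern_roots _)) mcoeff0 mcoeff_signature // ifT; last first.
  by rewrite sum_nat_eq0; apply/forallP => i; rewrite eqb0 ea.
apply/eqP; rewrite mulf_neq0 ?expf_neq0 //; apply/prodf_neq0 => i _.
have := even_todd_L (ea i); rewrite mnmE; case: ifP => _ /=.
  by rewrite L_series1 => e; apply/eqP => e0; move: e; rewrite e0 mulr0.
by rewrite expr0 mul1r L_series0 => ->.
Qed.

Lemma euler_notin_signature : euler n \notin <[signature m]>%VS.
Proof.
apply/negP => /vlineP[k].
(* The monomial x_1 ... x_n has coefficient 1 in the Euler number and 0 in the signature. *)
pose a : 'X_{1..n} := [multinom 1%N | i < n].
have dega : mdeg a = n.
  rewrite mdegE (eq_bigr (fun=> 1%N)) => [|i _]; rewrite ?mnmE //.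
  by rewrite sum_nat_const card_ord muln1.
have oa : odd_exps a = n.
  rewrite /odd_exps (eq_bigr (fun=> 1%N)) => [|i _]; rewrite ?mnmE //.
  by rewrite sum_nat_const card_ord muln1.
move/(congr1 (fun u => (chern_roots u)@_a)); rewrite mcoeff_chern_rootsZ.
rewrite mcoeff_euler // mcoeff_signature // oa eqxx ifF ?mulr0 //.
by rewrite /n; lia.
Qed.

End Intersection.

Theorem theorem6 (m : nat) (hm : (1 <= m)%N) :
  \dim (EP m :&: HT m)%VS = 2%N /\
  (EP m :&: HT m)%VS = <<[:: euler (2 * m); signature m]>>%VS.
Proof.
suff E : (EP m :&: HT m)%VS = <<[:: euler (2 * m); signature m]>>%VS.
  (* [free] unfolds to the equality of the dimension of the span with the length 2. *)
  split=> //; rewrite E; apply/eqP; apply: (_ : free _).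
  rewrite free_cons seq1_free signature_neq0 // span_seq1.
  by rewrite euler_notin_signature.
apply/eqP; rewrite eqEsubv; apply/andP; split.
  apply/subvP => u /(cap_EP_HT hm)[x [y ->]].
  by rewrite rpredD // rpredZ // memv_span // !inE eqxx ?orbT.
apply/span_subvP => u; rewrite !inE memv_cap => /orP[]/eqP ->.
  rewrite (subvP (addvSl _ _)) ?memv_line //=.
  by rewrite euler_todd; apply: sum_span_image.
by rewrite signature_EP signature_todd; apply: sum_span_image.
Qed.
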